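(* Let $G$ be a graph with $n\ge 2$ vertices, $m$ edges and degree sequence $d_1,\ldots,d_n$, with Laplacian eigenvalues $\mu_1\ge\mu_2\ge\cdots\ge\mu_{n-1}\ge\mu_n=0$. Then $$\frac{2}{n-1}\Big((n-1)(Z_g(G)+2m)-4m^2\Big)^{\frac12}\ \le\ S_L(G).$$
   Context: Graphs are finite, simple and undirected. The Laplacian matrix is $L(G)=D(G)-A(G)$ (degree matrix minus adjacency matrix), and the Laplacian spread is $S_L(G)=\mu_1-\mu_{n-1}$. The first Zagreb index is $Z_g(G)=\sum_{i=1}^n d_i^2$. *)

(* Defs.v *)
From mathcomp Require Import all_boot all_order all_algebra.
From mathcomp Require Import complex.

Set Implicit Arguments.
Unset Strict Implicit.
Unset Printing Implicit Defensive.

Import Order.TTheory GRing.Theory Num.Theory.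
Local Open Scope ring_scope.

Record sgraph (V : finType) := SGraph {
  adj : rel V;
  adj_sym : symmetric adj;
  adj_irr : irreflexive adj
}.

Section Graph.
Variables (V : finType) (G : sgraph V).

Definition deg (x : V) : nat := #|[set y | adj G x y]|.

Definition edges : {set {set V}} :=
  [set [set p.1; p.2] | p : V * V & adj G p.1 p.2].

Definition zagreb : nat := (\sum_(x : V) deg x ^ 2)%N.

End Graph.

Section Spectrum.
Variable R : rcfType.

(* [s] lists, with algebraic multiplicity and in nonincreasing order, all the
   eigenvalues of [A]. *)
Definition is_spectrum n (A : 'M[R]_n) (s : seq R) : bool :=
  sorted >=%R s && (char_poly A == \prod_(a <- s) ('X - a%:P)).

Lemma char_poly_conj (F : fieldType) n (P D : 'M[F]_n) :
  P \in unitmx -> char_poly (invmx P *m D *m P) = char_poly D.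
Proof.
move=> Pu; pose c := map_mx (@polyC F) : 'M[F]_n -> 'M[{poly F}]_n.
have cVc : c (invmx P) *m c P = 1%:M by rewrite -map_mxM mulVmx // map_mx1.
have cE : char_poly_mx (invmx P *m D *m P)
          = c (invmx P) *m char_poly_mx D *m c P.
  rewrite /char_poly_mx mulmxBr mulmxBl -/(c _) -/(c D) /c !map_mxM.
  by rewrite mul_mx_scalar -scalemxAl -/(c P) -/(c (invmx P)) cVc scalemx1.
by rewrite /char_poly cE !det_mulmx mulrAC -det_mulmx cVc det1 mul1r.
Qed.

Lemma symmetric_spectrum_exists n (A : 'M[R]_n) :
  A^T = A -> exists s, is_spectrum A s.
Proof.
move=> symA; pose B := map_mx (real_complex R) A.
have Breal : B \is a mxOver Num.real.
  by apply/mxOverP => i j; rewrite mxE complex_real.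
have Bsym : B \is symmetricmx.
  apply/is_hermitianmxP; rewrite expr0 scale1r; apply/matrixP => i j.
  by rewrite !mxE -[in LHS]symA mxE.
have Bherm := realsym_hermsym Bsym Breal.
have /orthomx_spectralP Beq := hermitian_normalmx Bherm.
have /mxOverP dreal := hermitian_spectral_diag_real Bherm.
set d := spectral_diag B in Beq dreal.
pose t := [seq complex.Re (d 0 i) | i <- enum 'I_n].
exists (sort >=%R t); apply/andP; split.
  by apply: sort_sorted => x y; exact: le_total.
rewrite (perm_big t) /=; last by rewrite perm_sort.
apply/eqP/(map_poly_inj (real_complex R)); rewrite map_char_poly -/B Beq.
rewrite char_poly_conj ?spectral_unit // char_poly_trig ?diag_mx_is_trig //.
rewrite rmorph_prod /= big_map big_enum /=.
apply: eq_bigr => i _; rewrite rmorphB /= map_polyX map_polyC /=.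
by rewrite mxE eqxx mulr1n RRe_real.
Qed.

End Spectrum.

Section LaplacianSpectrum.
Variables (R : rcfType) (V : finType) (G : sgraph V).

(* The vertices are numbered by [enum_val : 'I_#|V| -> V]. *)
Definition adjacency_mx : 'M[R]_#|V| :=
  \matrix_(i, j) (adj G (enum_val i) (enum_val j))%:R.

Definition degree_mx : 'M[R]_#|V| :=
  diag_mx (\row_i (deg G (enum_val i))%:R).

Definition laplacian : 'M[R]_#|V| := degree_mx - adjacency_mx.

Lemma laplacian_sym : laplacian^T = laplacian.
Proof.
rewrite /laplacian linearB /= tr_diag_mx; congr (_ - _).
by apply/matrixP => i j; rewrite !mxE adj_sym.
Qed.

Definition laplacian_spectrum : seq R :=
  xchoose (symmetric_spectrum_exists laplacian_sym).

Lemma laplacian_spectrumP : is_spectrum laplacian laplacian_spectrum.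
Proof. exact: xchooseP. Qed.

(* Numbered from 1: [laplacian_eig 1] is the largest eigenvalue and
   [laplacian_eig #|V|] the smallest. *)
Definition laplacian_eig (k : nat) : R := nth 0 laplacian_spectrum k.-1.

Definition laplacian_spread : R := laplacian_eig 1 - laplacian_eig #|V|.-1.

End LaplacianSpectrum.

(* Main.v *)
Require Import Defs.
From mathcomp Require Import all_boot all_order all_algebra.
From mathcomp Require Import ring lra.

Import Order.TTheory GRing.Theory Num.Theory.
Local Open Scope ring_scope.

(** The Laplacian [L] is positive semidefinite and kills the all-ones vector,
    so its smallest eigenvalue is 0.  Dropping one copy of it leaves [n - 1]
    eigenvalues, the largest and the smallest of which differ by the spread
    ([laplacian_spectrum_split]).  Their first two power sums are traces:
    [\tr L] is the sum of the degrees, that is [2 m] ([trace_laplacian]), and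
    [\tr (L *m L)] is the sum of the squared entries of [L], that is
    [Z_g + 2 m] ([trace_laplacian_sqr]).

    Hence [((n - 1) (Z_g + 2 m) - 4 m ^ 2) / (n - 1) ^ 2] is the variance of
    these [n - 1] numbers.  By Popoviciu's inequality ([popoviciu]) the
    variance of numbers in an interval of length [S] is at most [(S / 2) ^ 2];
    taking square roots gives the theorem.

    That the trace of [L *m L] is the sum of the squared eigenvalues is read
    off the characteristic polynomial of [L *m L], whose roots
    are the squares of the roots for [L] ([char_poly_sqr]). *)

Set Implicit Arguments.

(** * Traces as power sums of eigenvalues *)

Lemma char_poly_comp (F : comNzRingType) n (A : 'M[F]_n) (q : {poly F}) :
  char_poly A \Po q = \det (q%:M - map_mx polyC A).
Proof.
rewrite /char_poly -det_map_mx; congr (\det _).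
rewrite /char_poly_mx map_mxB map_scalar_mx /= comp_polyX; congr (_ - _).
by apply/matrixP => i j; rewrite !mxE comp_polyC.
Qed.

Lemma prod_XsubC_comp (F : comNzRingType) I (s : seq I) (f : I -> F) q :
  (\prod_(i <- s) ('X - (f i)%:P)) \Po q = \prod_(i <- s) (q - (f i)%:P).
Proof.
rewrite rmorph_prod /=; apply: eq_bigr => i _.
by rewrite comp_polyB comp_polyX comp_polyC.
Qed.

Lemma size_char_poly_roots (F : idomainType) n (A : 'M[F]_n) (s : seq F) :
  char_poly A = \prod_(a <- s) ('X - a%:P) -> size s = n.
Proof.
by move=> cA; apply: succn_inj; rewrite -(size_char_poly A) cA size_prod_XsubC.
Qed.

Lemma comp_poly_Xn_inj (F : comNzRingType) k : (0 < k)%N ->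
  injective (fun p : {poly F} => p \Po 'X^k).
Proof.
move=> k_gt0 p q /= /polyP pq; apply/polyP => i.
by have := pq (i * k)%N; rewrite !coef_comp_poly_Xn // dvdn_mull // mulnK.
Qed.

(** With the polynomial entries of [A] understood, [X^2 - A^2] factors as
    [(X - A) (X + A)].  Taking determinants gives the characteristic polynomial
    of [A^2] evaluated at [X^2] as the product of all
    [(X - a) (X + a) = X^2 - a^2], and substituting [X^2] is injective. *)
Lemma char_poly_sqr (F : idomainType) n (A : 'M[F]_n) (s : seq F) :
  char_poly A = \prod_(a <- s) ('X - a%:P) ->
  char_poly (A *m A) = \prod_(a <- s) ('X - (a ^+ 2)%:P).
Proof.
move=> cA; pose N := map_mx polyC A.
have cX : \det ('X%:M - N) = \prod_(a <- s) ('X - a%:P) by [].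
have cN : \det ('X%:M + N) = \prod_(a <- s) ('X + a%:P).
  (* Substitute [- 'X]; the two signs [(-1) ^+ n] cancel as [size s = n]. *)
  have -> : 'X%:M + N = -1 *: ((- 'X)%:M - N).
    by rewrite scaleN1r raddfN /= -opprD opprK.
  rewrite detZ -char_poly_comp cA prod_XsubC_comp -(size_char_poly_roots cA).
  elim: s {cA cX} => [|a s IH] /=; first by rewrite !big_nil mul1r.
  by rewrite !big_cons -IH exprS; ring.
apply: (@comp_poly_Xn_inj _ 2) => //=.
rewrite char_poly_comp prod_XsubC_comp.
have -> : ('X^2)%:M - map_mx polyC (A *m A) = ('X%:M - N) *m ('X%:M + N).
  rewrite mulmxDr !mulmxBl -scalar_mxM -expr2 map_mxM -/N.
  by rewrite scalar_mxC addrA subrK.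
rewrite det_mulmx cX cN -big_split /=; apply: eq_bigr => a _.
by rewrite polyC_exp subr_sqr.
Qed.

Lemma trace_char_poly_roots (F : idomainType) n (A : 'M[F]_n) I (s : seq I)
    (f : I -> F) :
  char_poly A = \prod_(i <- s) ('X - (f i)%:P) -> \tr A = \sum_(i <- s) f i.
Proof.
rewrite -(big_map f xpredT (fun a => 'X - a%:P)) -(big_map f xpredT id).
move: (map f s) => {}s cA; have sz := size_char_poly_roots cA.
have [n0|n_gt0] := posnP n.
  have -> : s = [::] by apply: size0nil; rewrite sz.
  rewrite big_nil /mxtrace big_pred0 // => -[i lt_in].
  by case/negP: (lt_in); rewrite n0.
apply: oppr_inj; rewrite -char_poly_trace // cA -[in LHS]sz.
by rewrite coefPn_prod_XsubC // sz -lt0n.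
Qed.

(** * Popoviciu's inequality on variances *)

(** Summing [0 <= (b - x) (x - a)] over [s] bounds the sum of squares by
    [(a + b) T - N a b], where [N] is the length and [T] the sum of [s]; the
    two sides of the claim then differ by at least
    [(T - N (a + b) / 2) ^ 2]. *)
Lemma popoviciu (R : realFieldType) (s : seq R) (a b : R) :
  {in s, forall x, a <= x <= b} ->
  (size s)%:R * (\sum_(x <- s) x ^+ 2) - (\sum_(x <- s) x) ^+ 2
    <= ((size s)%:R / 2%:R * (b - a)) ^+ 2.
Proof.
move=> sab.
have : 0 <= \sum_(x <- s) (b - x) * (x - a).
  rewrite big_seq; apply: sumr_ge0 => x /sab /andP[ax xb].
  by rewrite mulr_ge0 // subr_ge0.
have -> : \sum_(x <- s) (b - x) * (x - a)
  = (a + b) * (\sum_(x <- s) x) - (\sum_(x <- s) x ^+ 2) - (size s)%:R * (a * b).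
  elim: s {sab} => [|x s IH]; first by rewrite !big_nil /=; ring.
  by rewrite !big_cons IH /= -[(size s).+1]addn1 natrD; ring.
move: (\sum_(x <- s) x ^+ 2) (\sum_(x <- s) x) => Q T H.
have := mulr_ge0 (ler0n R (size s)) H.
have := sqr_ge0 (T - (size s)%:R / 2%:R * (a + b)).
by lra.
Qed.

(** * The handshake lemma *)

(** Both sides count the ordered pairs of adjacent vertices: each edge
    [{x, y}] comes from exactly the two pairs [(x, y)] and [(y, x)]. *)
Lemma handshake (V : finType) (G : sgraph V) :
  (\sum_x deg G x = 2 * #|edges G|)%N.
Proof.
pose D := [set p : V * V | adj G p.1 p.2].
have -> : (\sum_x deg G x = #|D|)%N.
  rewrite -sum1_card (eq_bigl (fun p : V * V => true && adj G p.1 p.2)); last first.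
    by move=> p; rewrite inE.
  rewrite -(pair_big_dep xpredT (adj G) (fun _ _ => 1%N)) /=.
  by apply: eq_bigr => x _; rewrite sum1dep_card.
rewrite -sum1_card (partition_big_imset (fun p : V * V => [set p.1; p.2])) /=.
have -> : [set [set p.1; p.2] | p in D] = edges G.
  by apply/setP => e; apply/imsetP/imsetP => -[p pD ->]; exists p;
    rewrite // ?inE // in pD *.
rewrite mulnC -sum_nat_const; apply: eq_bigr => e /imsetP[[x y] /= xy ->].
rewrite inE /= in xy.
have nxy : x != y by apply: contraTneq xy => ->; rewrite adj_irr.
have nyx : (x, y) != (y, x) by rewrite xpair_eqE negb_and nxy.
(* The fibre over this edge is [[set (x, y); (y, x)]]. *)
rewrite sum1_card -[RHS]/(true.+1) -nyx -cards2; apply: eq_card => -[u v].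
rewrite unfold_in inE /= !inE; apply/andP/orP => [[uv /eqP/setP euv]|].
  have nuv : u != v by apply: contraTneq uv => ->; rewrite adj_irr.
  have /set2P[eu|eu] : u \in [set x; y] by rewrite -euv set21.
    have /set2P[ev|->] : v \in [set x; y] by rewrite -euv set22.
      by rewrite eu ev eqxx in nuv.
    by left; rewrite eu.
  have /set2P[->|ev] : v \in [set x; y] by rewrite -euv set22.
    by right; rewrite eu.
  by rewrite eu ev eqxx in nuv.
by case=> /eqP[-> ->]; split; rewrite // ?(adj_sym G y) // setUC.
Qed.

(** * The Laplacian matrix *)

Section Laplacian.
Variables (R : rcfType) (V : finType) (G : sgraph V).
Local Notation L := (laplacian R G).
Local Notation a i j := (adj G (enum_val i) (enum_val j)).
Local Notation d i := (deg G (enum_val i)).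

Lemma sum_enum_val (F : V -> R) :
  \sum_(i < #|V|) F (enum_val i) = \sum_x F x.
Proof. by rewrite [RHS](reindex _ (onW_bij _ (@enum_val_bij V))). Qed.

Lemma laplacianE i j : L i j = (d i)%:R *+ (i == j) - (a i j)%:R.
Proof. by rewrite !mxE. Qed.

Lemma sum_adj (i : 'I_#|V|) : \sum_(j < #|V|) (a i j)%:R = (d i)%:R :> R.
Proof.
rewrite (sum_enum_val (fun y => (adj G (enum_val i) y)%:R)) -natr_sum.
by rewrite /deg -sum1dep_card [in RHS]big_mkcond.
Qed.

Lemma laplacian_row_sum i : \sum_(j < #|V|) L i j = 0.
Proof.
under eq_bigr do rewrite laplacianE.
rewrite sumrB sum_adj (bigD1 i) //= eqxx big1 ?addr0 ?subrr // => j.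
by rewrite eq_sym => /negPf ->.
Qed.

Lemma trace_laplacian : \tr L = 2%:R * #|edges G|%:R.
Proof.
rewrite -natrM -handshake natr_sum -sum_enum_val; apply: eq_bigr => i _.
by rewrite laplacianE adj_irr eqxx subr0.
Qed.

(** As [L] is symmetric, this trace is the sum of its squared entries: row [i]
    contributes [d i ^+ 2] from the diagonal and 1 for each neighbour. *)
Lemma trace_laplacian_sqr :
  \tr (L *m L) = (zagreb G)%:R + 2%:R * #|edges G|%:R.
Proof.
rewrite -natrM -handshake !natr_sum -!sum_enum_val -big_split /=.
apply: eq_bigr => i _; rewrite mxE -[X in _ = _ + X]sum_adj.
rewrite (bigD1 i) //= [in RHS](bigD1 i) //= adj_irr add0r natrX.
rewrite laplacianE eqxx adj_irr subr0 expr2; congr (_ + _).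
apply: eq_bigr => j /negPf nij.
by rewrite !laplacianE nij eq_sym nij !sub0r mulrNN adj_sym -natrM mulnb andbb.
Qed.

(** The factor 2 is there because the sum runs over ordered pairs, and so
    meets every edge twice. *)
Lemma laplacian_form (v : 'rV[R]_#|V|) :
  2%:R * (v *m L *m v^T) 0 0
    = \sum_(i < #|V|) \sum_(j < #|V|) (a i j)%:R * (v 0 i - v 0 j) ^+ 2.
Proof.
pose S := \sum_(i < #|V|) \sum_(j < #|V|) (a i j)%:R * v 0 i ^+ 2.
pose P := \sum_(i < #|V|) \sum_(j < #|V|) (a i j)%:R * (v 0 i * v 0 j).
have -> : (v *m L *m v^T) 0 0 = S - P.
  rewrite -sumrB mxE; apply: eq_bigr => j _.
  rewrite -mulr_suml sum_adj !mxE mulr_suml.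
  under eq_bigr do rewrite laplacianE mulrBr mulrBl.
  rewrite sumrB (bigD1 j) //= eqxx big1 ?addr0 => [|i /negPf ->]; last first.
    by rewrite mulr0 mul0r.
  congr (_ - _); first by rewrite mulrAC mulrC.
  by apply: eq_bigr => i _; rewrite adj_sym; ring.
have S' : S = \sum_(i < #|V|) \sum_(j < #|V|) (a i j)%:R * v 0 j ^+ 2.
  rewrite [RHS]exchange_big; apply: eq_bigr => i _; apply: eq_bigr => j _.
  by rewrite adj_sym.
have -> : 2%:R * (S - P) = S + S - 2%:R * P by ring.
rewrite {2}S' -big_split mulr_sumr -sumrB; apply: eq_bigr => i _.
by rewrite -big_split mulr_sumr -sumrB; apply: eq_bigr => j _ /=; ring.
Qed.

Lemma eigenvalue_laplacian_ge0 x : eigenvalue L x -> 0 <= x.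
Proof.
case/eigenvalueP => v vL v0.
have : 0 <= 2%:R * (v *m L *m v^T) 0 0.
  rewrite laplacian_form; apply: sumr_ge0 => i _; apply: sumr_ge0 => j _.
  by rewrite mulr_ge0 ?ler0n ?sqr_ge0.
rewrite vL -scalemxAl mxE pmulr_rge0 ?ltr0n // pmulr_lge0 //.
have /rV0Pn[j vj0] := v0.
rewrite mxE (bigD1 j) //= mxE ltr_pwDl //.
  by rewrite lt_def mulf_neq0 //= -expr2 sqr_ge0.
by apply: sumr_ge0 => i _; rewrite mxE -expr2 sqr_ge0.
Qed.

Lemma eigenvalue_laplacian0 : (0 < #|V|)%N -> eigenvalue L 0.
Proof.
move=> V0; apply/eigenvalueP; exists (const_mx 1).
  rewrite scale0r; apply/rowP => j; rewrite !mxE -[RHS](laplacian_row_sum j).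
  by apply: eq_bigr => i _; rewrite mxE mul1r -[in LHS]laplacian_sym mxE.
by apply/negP => /eqP/rowP/(_ (Ordinal V0))/eqP; rewrite !mxE oner_eq0.
Qed.

(** The eigenvalue 0 occurs and is a lower bound of the spectrum, so it sits at
    the end of the nonincreasing list. *)
Lemma laplacian_spectrum_split : (0 < #|V|)%N ->
  exists2 s, laplacian_spectrum R G = rcons s 0 & size s = #|V|.-1.
Proof.
move=> V0; have /andP[sorted_s /eqP cL] := laplacian_spectrumP R G.
have sz := size_char_poly_roots cL.
have s_eig x : (x \in laplacian_spectrum R G) = eigenvalue L x.
  by rewrite eigenvalue_root_char cL root_prod_XsubC.
have := eigenvalue_laplacian0 V0; rewrite -s_eig.
have : {in laplacian_spectrum R G, forall x, 0 <= x}.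
  by move=> x; rewrite s_eig; exact: eigenvalue_laplacian_ge0.
move: sorted_s sz; case/lastP: (laplacian_spectrum R G) => // s x.
rewrite size_rcons => srt sz s_ge0 s0; exists s; last by rewrite -sz.
congr rcons; apply/le_anti; rewrite s_ge0 ?mem_rcons ?mem_head // andbT.
move: s0; rewrite mem_rcons inE => /predU1P[<- //|s0].
move: srt; rewrite -rev_sorted rev_rcons /= path_sortedE => [/andP[/allP + _]|].
  by apply; rewrite mem_rev.
by move=> ? ? ? xy yz; exact: le_trans yz.
Qed.

End Laplacian.

Unset Implicit Arguments.

(** * The lower bound on the spread *)

Theorem theorem23 (R : rcfType) (V : finType) (G : sgraph V)
    (n m : nat) (hn : #|V| = n) (hm : #|edges G| = m) (hn2 : (2 <= n)%N) :
  2%:R / (n.-1)%:R *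
    Num.sqrt ((n.-1)%:R * ((zagreb G)%:R + 2%:R * m%:R) - 4%:R * m%:R ^+ 2)
  <= laplacian_spread R G.
Proof.
have V0 : (0 < #|V|)%N by rewrite hn ltnW.
have [s es sz] := laplacian_spectrum_split R G V0.
have /andP[sorted_s /eqP cL] := laplacian_spectrumP R G.
have S1 := trace_char_poly_roots _ cL.
have S2 := trace_char_poly_roots _ (char_poly_sqr cL).
rewrite es !big_rcons /= ?expr0n ?addr0 ?add0r in S1 S2.
rewrite trace_laplacian hm in S1; rewrite trace_laplacian_sqr hm in S2.
rewrite hn in sz; have N0 : (0 < n.-1)%N by rewrite -subn1 subn_gt0.
rewrite /laplacian_spread /laplacian_eig es !nth_rcons sz hn /= N0.
have -> : (n.-1.-1 < n.-1)%N by rewrite prednK.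
have ge_trans : transitive (>=%R : rel R).
  by move=> y x z xy yz; exact: le_trans yz xy.
set M := nth 0 s 0; set c := nth 0 s n.-1.-1.
rewrite es in sorted_s.
have srt : sorted >=%R s.
  by apply: (subseq_sorted ge_trans) sorted_s; exact: subseq_rcons.
have s_cM : {in s, forall x, c <= x <= M}.
  move=> x /(nthP 0)[i]; rewrite sz => lti <-.
  have ge_nth := sorted_leq_nth ge_trans lexx 0 srt.
  apply/andP; split; apply: ge_nth; rewrite ?inE ?sz ?prednK //.
  by rewrite -ltnS prednK.
have := popoviciu c M s_cM; rewrite sz -S1 -S2 exprMn.
have -> : 2%:R ^+ 2 = 4%:R :> R by rewrite -natrX.
move/ler_wsqrtr; rewrite sqrtr_sqr ger0_norm; last first.
  have /s_cM/andP[le_cM _] : M \in s by rewrite mem_nth ?sz.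
  by rewrite mulr_ge0 ?divr_ge0 ?ler0n // subr_ge0.
move=> le_sqrt; rewrite mulrC -ler_pdivlMr ?divr_gt0 ?ltr0n //.
by rewrite invf_div [leRHS]mulrC.
Qed.
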